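(* Let $(A,\Lambda,\phi,\cdot,\{\bullet_\lambda\}_{\lambda\in\Lambda})$ be a dynamical skew brace, let $f^\lambda_a(b)=a^{-1}(a\bullet_\lambda b)$ and $S_\lambda=\{(a,f^\lambda_a):a\in A\}$ for $\lambda\in\Lambda$, and let $\mathcal S=\{S_\lambda\}_{\lambda\in\Lambda}$. Let $Q$ be the associated left unital associative semiloopoid over $\Lambda$, with arrows $[\lambda\Vert a]$, $(\lambda,a)\in\Lambda\times A$, source $\lambda$, target $\phi(\lambda,a)$, and operation $[\lambda\Vert a]\bullet[\phi(\lambda,a)\Vert b]=[\lambda\Vert a\bullet_\lambda b]$. Then $Q$ has the structure of a quiver-theoretic skew brace, and the braiding $\sigma$ on $Q$ (associated with this quiver-theoretic skew brace) is exactly the map $$\begin{aligned}\sigma\big([\lambda\Vert a]\otimes[\phi(\lambda,a)\Vert b]\big)&=\big[\lambda\big\Vert a^{-1}(a\bullet_\lambda b)\big]\otimes\big[\phi(\lambda,a^{-1}(a\bullet_\lambda b))\big\Vert (a^{-1}(a\bullet_\lambda b))\backslash_\lambda(a\bullet_\lambda b)\big]\\&=\big[\lambda\big\Vert f^\lambda_a(b)\big]\otimes\big[\phi(\lambda,f^\lambda_a(b))\big\Vert f^\lambda_a(b)\backslash_\lambda\big(af^\lambda_a(b)\big)\big].\end{aligned}$$ If moreover $\mathcal S$ is unital (i.e., $A$ is zero-symmetric), then $Q$ is a skew bracoid, and $\sigma$ is the corresponding non-degenerate braiding on the groupoid $Q$.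
   Context: Dynamical skew brace over a nonempty set $\Lambda$: a group $(A,\cdot)$, a map $\phi\colon\Lambda\times A\to\Lambda$, and binary operations $\bullet_\lambda$ ($\lambda\in\Lambda$) on $A$ with $a\bullet_\lambda(\,\cdot\,)$ bijective for all $a,\lambda$, such that, for all $\lambda\in\Lambda$ and $a,b,c\in A$, $a\bullet_\lambda(b\bullet_{\phi(\lambda,a)}c)=(a\bullet_\lambda b)\bullet_\lambda c$ and $a\bullet_\lambda(b\cdot c)=(a\bullet_\lambda b)\cdot a^{-1}\cdot(a\bullet_\lambda c)$. Here $a^{-1}$ is the inverse in $(A,\cdot)$, the symbol $\cdot$ is often omitted, and $a\backslash_\lambda c$ is the unique element with $a\bullet_\lambda(a\backslash_\lambda c)=c$. It is zero-symmetric if $1_A\bullet_\lambda b=b$ for all $\lambda\in\Lambda$, $b\in A$. The maps $f^\lambda_a$ are automorphisms of $(A,\cdot)$, so $S_\lambda\subseteq A\rtimes\operatorname{Aut}(A)$; $\mathcal S$ is unital if $(1_A,\operatorname{id}_A)\in S_\lambda$ for all $\lambda$. A quiver over $\Lambda$ is a nonempty set $Q$ with maps $\mathfrak s,\mathfrak t\colon Q\to\Lambda$ (source, target) such that $\Lambda=\operatorname{im}\mathfrak s\cup\operatorname{im}\mathfrak t$; $Q(\lambda,\Lambda)$, resp. $Q(\Lambda,\lambda)$, is the set of arrows with source, resp. target, $\lambda$. $Q\otimes Q$ is the quiver of pairs $x\otimes y$ with $\mathfrak t(x)=\mathfrak s(y)$, source $\mathfrak s(x)$, target $\mathfrak t(y)$.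 Morphisms over $\Lambda$ preserve sources and targets. Left unital associative semiloopoid over $\Lambda$: a quiver $\mathcal G$ with an associative operation $\bullet\colon\mathcal G\otimes\mathcal G\to\mathcal G$ (a morphism over $\Lambda$) such that $x\bullet(\,\cdot\,)\colon\mathcal G(\mathfrak t(x),\Lambda)\to\mathcal G(\mathfrak s(x),\Lambda)$ is bijective for all $x$ (the unique $z$ with $x\bullet z=y$ is written $x\backslash y$), and such that for all $\lambda\in\operatorname{im}\mathfrak t$ there is a loop $\mathbf 1_\lambda$ on $\lambda$ with $x\bullet\mathbf 1_\lambda=x$, $\mathbf 1_\lambda\bullet y=y$ for $x\in\mathcal G(\Lambda,\lambda)$, $y\in\mathcal G(\lambda,\Lambda)$. Put $\Lambda_{\mathrm{un}}=\operatorname{im}\mathfrak t$. If $\Lambda_{\mathrm{un}}=\Lambda$, it is a groupoid. Quiver-theoretic skew brace: a left unital associative semiloopoid $(\mathcal G,\bullet)$ with a group operation $\cdot_\lambda$ on $\mathcal G(\lambda,\Lambda)$ for every $\lambda\in\Lambda$, such that $x\bullet(y\cdot_{\mathfrak t(x)}z)=(x\bullet y)\cdot_{\mathfrak s(x)}x^{-1}\cdot_{\mathfrak s(x)}(x\bullet z)$ whenever $\mathfrak t(x)=\mathfrak s(y)=\mathfrak s(z)$ ($x^{-1}$ the inverse of $x$ for $\cdot_{\mathfrak s(x)}$). It is a skew bracoid if $\mathcal G$ is a groupoid. The associated braiding is $x\otimes y\mapsto(x\rightharpoonup y)\otimes(x\leftharpoonup y)$ with $x\rightharpoonup y=x^{-1}\cdot_{\mathfrak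 s(x)}(x\bullet y)$, $x\leftharpoonup y=(x\rightharpoonup y)\backslash(x\bullet y)$. A braiding on a left unital associative semiloopoid is a bijective morphism $\sigma(x\otimes y)=(x\rightharpoonup y)\otimes(x\leftharpoonup y)$ from $\mathcal G\otimes\mathcal G$ to itself over $\Lambda$ such that $\sigma(x\otimes\mathbf 1_{\mathfrak t(x)})=\mathbf 1_{\mathfrak s(x)}\otimes x$ and $\sigma(\mathbf 1_{\mathfrak s(x)}\otimes x)=x\otimes\mathbf 1_{\mathfrak t(x)}$ for all $x$ with source and target in $\Lambda_{\mathrm{un}}$, and, for all composable $x,y,z$: $x\rightharpoonup(y\bullet z)=(x\rightharpoonup y)\bullet((x\leftharpoonup y)\rightharpoonup z)$; $x\leftharpoonup(y\bullet z)=(x\leftharpoonup y)\leftharpoonup z$; $(x\bullet y)\leftharpoonup z=(x\leftharpoonup(y\rightharpoonup z))\bullet(y\leftharpoonup z)$; $(x\bullet y)\rightharpoonup z=x\rightharpoonup(y\rightharpoonup z)$; $(x\rightharpoonup y)\bullet(x\leftharpoonup y)=x\bullet y$. It is non-degenerate if all maps $x\rightharpoonup(\,\cdot\,)\colon\mathcal G(\mathfrak t(x),\Lambda)\to\mathcal G(\mathfrak s(x),\Lambda)$ and $(\,\cdot\,)\leftharpoonup y\colon\mathcal G(\Lambda,\mathfrak s(y))\to\mathcal G(\Lambda,\mathfrak t(y))$ are bijective.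
   Formalization: It is assumed that φ(λ,a•_λ b)=φ(φ(λ,a),b), so that • on Q preserves targets, and, in the unital part, that S_{φ(λ,1)}=S_λ implies φ(λ,1)=λ; else Q need not be a groupoid (A trivial, Λ={0,1}, φ constant 0). *)

(* Defs.v *)
From HB Require Import structures.
From mathcomp Require Import all_boot.
From mathcomp Require Import boolp classical_sets.
Set Implicit Arguments.
Unset Strict Implicit.
Unset Printing Implicit Defensive.

Local Open Scope group_scope.

(** * Quivers over a set of vertices *)

(* [preQuiver] is the bare data of arrows with source and target; the
   nonemptiness conditions are added in [quiver] because they may fail for
   Q ⊗ Q even when they hold for Q. *)
Record preQuiver (V : Type) := PreQuiver {
  arrow :> Type;
  src : arrow -> V;
  tgt : arrow -> V }.

Record quiver (V : Type) := Quiver {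
  quiver_pre :> preQuiver V;
  quiver_inh : inhabited quiver_pre;
  quiver_cover :
    forall v : V, (exists x : quiver_pre, src x = v) \/
                  (exists x : quiver_pre, tgt x = v) }.

(* Q(v, V) and Q(V, v). *)
Definition out V (Q : preQuiver V) (v : V) : Type := {x : Q | src x = v}.
Definition inn V (Q : preQuiver V) (v : V) : Type := {x : Q | tgt x = v}.

Record composable V (Q : preQuiver V) := Tensor {
  lft : Q;
  rgt : Q;
  composableP : tgt lft = src rgt }.
Arguments Tensor {V Q} lft rgt composableP.
Arguments composableP {V Q}.

Definition tensor V (Q : preQuiver V) : preQuiver V :=
  @PreQuiver V (composable Q) (fun p => src (lft p)) (fun p => tgt (rgt p)).

Record qmorphism V (Q Q' : preQuiver V) := QMorphism {
  qfun :> Q -> Q';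
  qfun_src : forall x, src (qfun x) = src x;
  qfun_tgt : forall x, tgt (qfun x) = tgt x }.

(** * Left unital associative semiloopoids *)

Definition ltrans V (Q : preQuiver V) (m : qmorphism (tensor Q) Q) (x : Q)
    (y : out Q (tgt x)) : out Q (src x) :=
  exist _ (m (Tensor x (sval y) (esym (svalP y)))) (qfun_src m _).

(* The vertices in the image of the target map. *)
Definition unv V (Q : preQuiver V) (v : V) : Prop := exists x : Q, tgt x = v.

(* Laws relating several composites quantify over all proofs of composability
   of the pairs involved; such proofs always exist, since the operations
   preserve sources and targets. *)
Record semiloopoid (V : Type) := Semiloopoid {
  sl_quiver :> quiver V;
  sl_mul : qmorphism (tensor sl_quiver) sl_quiver;
  sl_mulA : forall (x y z : sl_quiver) (hxy : tgt x = src y) (hyz : tgt y = src z)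
      (h1 : tgt (sl_mul (Tensor x y hxy)) = src z)
      (h2 : tgt x = src (sl_mul (Tensor y z hyz))),
    sl_mul (Tensor (sl_mul (Tensor x y hxy)) z h1) =
    sl_mul (Tensor x (sl_mul (Tensor y z hyz)) h2);
  sl_bij : forall x : sl_quiver, bijective (ltrans sl_mul (x := x));
  sl_one : forall v : V, unv sl_quiver v -> sl_quiver;
  sl_one_src : forall v (hv : unv sl_quiver v), src (sl_one hv) = v;
  sl_one_tgt : forall v (hv : unv sl_quiver v), tgt (sl_one hv) = v;
  sl_mul1 : forall v (hv : unv sl_quiver v) (x : sl_quiver)
      (h : tgt x = src (sl_one hv)), sl_mul (Tensor x (sl_one hv) h) = x;
  sl_1mul : forall v (hv : unv sl_quiver v) (y : sl_quiver)
      (h : tgt (sl_one hv) = src y), sl_mul (Tensor (sl_one hv) y h) = y }.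

Definition is_groupoid V (G : semiloopoid V) : Prop := forall v : V, unv G v.

Lemma bijective_preim T T' (f : T -> T') :
  bijective f -> forall y, exists x, f x = y.
Proof. by case=> g _ gK y; exists (g y). Qed.

(* The left division x \ y, defined when x and y have the same source. *)
Definition sl_ldiv V (G : semiloopoid V) (x y : G) (h : src y = src x) :
    out G (tgt x) :=
  sval (cid (bijective_preim (sl_bij x) (exist _ y h))).

Lemma sl_ldivK V (G : semiloopoid V) (x y : G) (h : src y = src x)
    (h' : tgt x = src (sval (sl_ldiv h))) :
  sl_mul G (Tensor x (sval (sl_ldiv h)) h') = y.
Proof.
rewrite /sl_ldiv in h' *; case: cid h' => z /= /(congr1 sval) /= zE h'.
by rewrite -[RHS]zE; congr (sl_mul G (Tensor _ _ _)); apply: Prop_irrelevance.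
Qed.

(** * Quiver-theoretic skew braces *)

Record qskew_brace_on V (G : semiloopoid V) := QSkewBrace {
  qsb_class : forall v : V, Group.axioms_ (out G v);
  qsb_fib := fun v : V => @Group.Pack (out G v) (qsb_class v) : groupType;
  qsb_law : forall (x : G) (y z : out G (tgt x)),
    ltrans (sl_mul G) ((y : qsb_fib (tgt x)) * (z : qsb_fib (tgt x))) =
    (ltrans (sl_mul G) y : qsb_fib (src x))
      * (exist _ x erefl : qsb_fib (src x))^-1
      * (ltrans (sl_mul G) z : qsb_fib (src x)) }.

Definition is_skew_bracoid V (G : semiloopoid V) (B : qskew_brace_on G) : Prop :=
  is_groupoid G.

Section AssociatedBraiding.
Variables (V : Type) (G : semiloopoid V) (B : qskew_brace_on G).

(* x ⇀ y = x^-1 · (x • y) as an element of the group G(src x, V). *)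
Definition qsb_harp (x : G) (y : out G (tgt x)) : out G (src x) :=
  (exist _ x erefl : qsb_fib B (src x))^-1
    * (ltrans (sl_mul G) y : qsb_fib B (src x)).

Lemma qsb_harp_src (x : G) (y : out G (tgt x)) :
  src (sval (ltrans (sl_mul G) y)) = src (sval (qsb_harp y)).
Proof. by rewrite (svalP (ltrans _ y)) (svalP (qsb_harp y)). Qed.

(* x ↼ y = (x ⇀ y) \ (x • y). *)
Definition qsb_larp (x : G) (y : out G (tgt x)) :
    out G (tgt (sval (qsb_harp y))) :=
  sl_ldiv (qsb_harp_src y).

Definition tensor_out (p : tensor G) : out G (tgt (lft p)) :=
  exist _ (rgt p) (esym (composableP p)).

Definition qsb_braiding_fun (p : tensor G) : tensor G :=
  Tensor (sval (qsb_harp (tensor_out p))) (sval (qsb_larp (tensor_out p)))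
         (esym (svalP (qsb_larp (tensor_out p)))).

Lemma qsb_braiding_src p : src (qsb_braiding_fun p) = src p.
Proof. exact: svalP (qsb_harp _). Qed.

Lemma qsb_braiding_tgt p : tgt (qsb_braiding_fun p) = tgt p.
Proof.
pose q := tensor_out p.
have h : tgt (sval (qsb_harp q)) = src (sval (qsb_larp q)).
  by rewrite (svalP (qsb_larp q)).
have := congr1 (@tgt V G) (sl_ldivK (h := qsb_harp_src q) h).
by rewrite !qfun_tgt.
Qed.

Definition qsb_braiding : qmorphism (tensor G) (tensor G) :=
  QMorphism qsb_braiding_src qsb_braiding_tgt.

End AssociatedBraiding.

(** * Braidings on a semiloopoid *)

Section Braiding.
Variables (V : Type) (G : semiloopoid V) (s : qmorphism (tensor G) (tensor G)).

Local Notation mul x y h := (sl_mul G (Tensor x y h)).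
Local Notation harp x y h := (lft (s (Tensor x y h))).
Local Notation larp x y h := (rgt (s (Tensor x y h))).

Record is_braiding : Prop := IsBraiding {
  braiding_bij : bijective s;
  braiding_x1 : forall (x : G) (hs : unv G (src x)) (ht : unv G (tgt x)),
    s (Tensor x (sl_one ht) (esym (sl_one_src ht))) =
    Tensor (sl_one hs) x (sl_one_tgt hs);
  braiding_1x : forall (x : G) (hs : unv G (src x)) (ht : unv G (tgt x)),
    s (Tensor (sl_one hs) x (sl_one_tgt hs)) =
    Tensor x (sl_one ht) (esym (sl_one_src ht));
  braiding_harpM : forall (x y z : G) (hxy : tgt x = src y) (hyz : tgt y = src z)
      (h1 : tgt x = src (mul y z hyz)) (h2 : tgt (larp x y hxy) = src z)
      (h3 : tgt (harp x y hxy) = src (harp (larp x y hxy) z h2)),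
    harp x (mul y z hyz) h1 = mul (harp x y hxy) (harp (larp x y hxy) z h2) h3;
  braiding_larpA : forall (x y z : G) (hxy : tgt x = src y) (hyz : tgt y = src z)
      (h1 : tgt x = src (mul y z hyz)) (h2 : tgt (larp x y hxy) = src z),
    larp x (mul y z hyz) h1 = larp (larp x y hxy) z h2;
  braiding_larpM : forall (x y z : G) (hxy : tgt x = src y) (hyz : tgt y = src z)
      (h1 : tgt (mul x y hxy) = src z) (h2 : tgt x = src (harp y z hyz))
      (h3 : tgt (larp x (harp y z hyz) h2) = src (larp y z hyz)),
    larp (mul x y hxy) z h1 =
    mul (larp x (harp y z hyz) h2) (larp y z hyz) h3;
  braiding_harpA : forall (x y z : G) (hxy : tgt x = src y) (hyz : tgt y = src z)
      (h1 : tgt (mul x y hxy) = src z) (h2 : tgt x = src (harp y z hyz)),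
    harp (mul x y hxy) z h1 = harp x (harp y z hyz) h2;
  braiding_mul : forall (x y : G) (h : tgt x = src y)
      (h' : tgt (harp x y h) = src (larp x y h)),
    mul (harp x y h) (larp x y h) h' = mul x y h }.

(* x ⇀ _ : G(tgt x, V) -> G(src x, V) and _ ↼ y : G(V, src y) -> G(V, tgt y). *)
Definition harp_map (x : G) (y : out G (tgt x)) : out G (src x) :=
  exist _ (harp x (sval y) (esym (svalP y))) (qfun_src s _).

Definition larp_map (y : G) (x : inn G (src y)) : inn G (tgt y) :=
  exist _ (larp (sval x) y (svalP x)) (qfun_tgt s _).

Definition nondegenerate : Prop :=
  (forall x : G, bijective (@harp_map x)) /\
  (forall y : G, bijective (@larp_map y)).

End Braiding.

(** * Dynamical skew braces *)

(* A [groupType] is an arbitrary, possibly infinite, group; the choice structure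
   it carries exists on every type by classical choice. *)
Record dyn_skew_brace (V : Type) (A : groupType) := DynSkewBrace {
  dsb_inh : inhabited V;
  dsb_phi : V -> A -> V;
  dsb_op : V -> A -> A -> A;
  dsb_bij : forall l a, bijective (dsb_op l a);
  dsb_opA : forall l a b c,
    dsb_op l a (dsb_op (dsb_phi l a) b c) = dsb_op l (dsb_op l a b) c;
  dsb_opM : forall l a b c,
    dsb_op l a (b * c) = dsb_op l a b * a^-1 * dsb_op l a c }.

Record automorphism (A : groupType) := Automorphism {
  aut_fun :> A -> A;
  aut_morph : {morph aut_fun : x y / x * y};
  aut_bij : bijective aut_fun }.

Definition aut_id (A : groupType) : automorphism A :=
  @Automorphism A id (fun x y => erefl) (Bijective (fun=> erefl) (fun=> erefl)).

Section DynSkewBrace.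
Variables (V : Type) (A : groupType) (D : dyn_skew_brace V A).

Local Notation phi := (dsb_phi D).
Local Notation op := (dsb_op D).

(* The left division a \_l c. *)
Definition dsb_ldiv (l : V) (a c : A) : A :=
  sval (cid (bijective_preim (dsb_bij D l a) c)).

Definition dsb_f (l : V) (a b : A) : A := a^-1 * op l a b.

Lemma dsb_f_morph l a : {morph dsb_f l a : x y / x * y}.
Proof. by move=> x y; rewrite /dsb_f dsb_opM !mulgA. Qed.

Lemma dsb_f_bij l a : bijective (dsb_f l a).
Proof.
case: (dsb_bij D l a) => g gK Kg; exists (fun c => g (a * c)) => b.
  by rewrite /dsb_f mulVKg gK.
by rewrite /dsb_f Kg mulKg.
Qed.

Definition dsb_f_aut (l : V) (a : A) : automorphism A :=
  Automorphism (@dsb_f_morph l a) (dsb_f_bij l a).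

(* S_l as a subset of the underlying set of A ⋊ Aut(A). *)
Definition dsb_S (l : V) : set (A * automorphism A)%type :=
  [set p | exists a : A, p = (a, dsb_f_aut l a)]%classic.

Definition dsb_unital : Prop := forall l, dsb_S l (1, aut_id A).

Definition zero_symmetric : Prop := forall l b, op l 1 b = b.

(* The indexing l |-> S_l does not repeat the same subset at l and at a
   different vertex phi l 1.  Zero-symmetry only gives that phi l 1 and l index
   the same operation, not that they are equal: for A trivial and phi constant
   on a two-point V, every phi l 1 is the same vertex, and the quiver below has
   a vertex that is not a target.  The condition holds when l |-> S_l is
   injective, and it is necessary for the quiver to be a groupoid. *)
Definition dsb_unit_indexed : Prop :=
  forall l, dsb_S (phi l 1) = dsb_S l -> phi l 1 = l.

(** ** The associated quiver and semiloopoid *)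

Definition dsb_preQuiver : preQuiver V :=
  @PreQuiver V (V * A)%type fst (fun x => phi x.1 x.2).

Lemma dsb_quiver_inh : inhabited dsb_preQuiver.
Proof. by case: (dsb_inh D) => l; exact: (inhabits (l, 1)). Qed.

Lemma dsb_quiver_cover v :
  (exists x : dsb_preQuiver, src x = v) \/ (exists x : dsb_preQuiver, tgt x = v).
Proof. by left; exists (v, 1). Qed.

Definition dsb_quiver : quiver V := Quiver dsb_quiver_inh dsb_quiver_cover.

(* The arrow [l || a]. *)
Definition dsb_arrow (l : V) (a : A) : dsb_quiver := (l, a).

(* The compatibility of phi with the operations, which says that
   [l || a] • [phi l a || b] = [l || a •_l b] has the right target.  The
   axioms of [dyn_skew_brace] only give that phi l (a •_l b) and
   phi (phi l a) b index the same operation, so the condition follows from them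
   when l |-> S_l is injective, but not in general (take A trivial and phi the
   swap of a two-point V). *)
Hypothesis phi_op : forall l a b, phi l (op l a b) = phi (phi l a) b.

Definition dsb_mul_fun (p : tensor dsb_quiver) : dsb_quiver :=
  dsb_arrow (lft p).1 (op (lft p).1 (lft p).2 (rgt p).2).

Lemma dsb_mul_tgt p : tgt (dsb_mul_fun p) = tgt p.
Proof. by case: p => -[l a] [m b] /= h; rewrite phi_op h. Qed.

Definition dsb_mul : qmorphism (tensor dsb_quiver) dsb_quiver :=
  @QMorphism V (tensor dsb_quiver) dsb_quiver dsb_mul_fun (fun=> erefl) dsb_mul_tgt.

Lemma dsb_mulA (x y z : dsb_quiver) (hxy : tgt x = src y) (hyz : tgt y = src z)
    (h1 : tgt (dsb_mul (Tensor x y hxy)) = src z)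
    (h2 : tgt x = src (dsb_mul (Tensor y z hyz))) :
  dsb_mul (Tensor (dsb_mul (Tensor x y hxy)) z h1) =
  dsb_mul (Tensor x (dsb_mul (Tensor y z hyz)) h2).
Proof.
case: x y z hxy hyz h1 h2 => [l a] [m b] [n c] /= hxy hyz h1 h2.
by rewrite /dsb_mul_fun /= -hxy dsb_opA.
Qed.

Lemma dsb_mul_bij (x : dsb_quiver) : bijective (ltrans dsb_mul (x := x)).
Proof.
case: x => l a; case: (dsb_bij D l a) => g gK Kg.
exists (fun y : out dsb_quiver l =>
  exist (fun z : dsb_quiver => src z = phi l a)
        (dsb_arrow (phi l a) (g (sval y).2)) erefl).
  by move=> [[m b] /= h]; apply: eq_exist; rewrite /= gK -h.
move=> [[m b] /= h]; apply: eq_exist; rewrite /= /dsb_mul_fun /dsb_arrow /= h.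
by congr pair; exact: Kg.
Qed.

Lemma dsb_op1 l a : op l a 1 = a.
Proof.
have := dsb_opM D l a 1 1; rewrite mulg1 -mulgA -[LHS]mulg1 => /mulgI.
by move=> /(congr1 (fun t => a * t)); rewrite mulg1 mulVKg.
Qed.

Lemma dsb_phi1 v : unv dsb_quiver v -> phi v 1 = v.
Proof. by case=> -[l a] /= <-; rewrite -phi_op dsb_op1. Qed.

Lemma dsb_1op v b : unv dsb_quiver v -> op v 1 b = b.
Proof.
case=> -[l a] /= <-; apply: (bij_inj (dsb_bij D l a)).
by rewrite dsb_opA dsb_op1.
Qed.

Definition dsb_one (v : V) (hv : unv dsb_quiver v) : dsb_quiver := dsb_arrow v 1.

Lemma dsb_mul1 v (hv : unv dsb_quiver v) (x : dsb_quiver)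
    (h : tgt x = src (dsb_one hv)) : dsb_mul (Tensor x (dsb_one hv) h) = x.
Proof. by case: x h => l a h; rewrite /= /dsb_mul_fun /= dsb_op1. Qed.

Lemma dsb_1mul v (hv : unv dsb_quiver v) (y : dsb_quiver)
    (h : tgt (dsb_one hv) = src y) : dsb_mul (Tensor (dsb_one hv) y h) = y.
Proof.
case: y h => m b h; rewrite /= /dsb_mul_fun /= dsb_1op //.
by congr pair; rewrite -[RHS]h /= dsb_phi1.
Qed.

Definition dsb_semiloopoid : semiloopoid V :=
  @Semiloopoid V dsb_quiver dsb_mul dsb_mulA dsb_mul_bij dsb_one
    (fun _ _ => erefl) dsb_phi1 dsb_mul1 dsb_1mul.

End DynSkewBrace.

(* Main.v *)
(** The group structure of [A] is carried over to each fibre [Q(l, V)] along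
    [a |-> [l || a]], and [sigma] is then given by the displayed formula.  The
    law for [(x • y) ⇀ z] says that [f] turns [•] into composition; this and the
    law for [x ⇀ (y • z)] come down to [a •_l b^-1 = a (a •_l b)^-1 a].  The laws
    for [↼] follow by left cancellation in [(x ⇀ y) • (x ↼ y) = x • y].  The map
    [sigma] is inverted by [(c, d) |-> (a, a \ e)] with [e = c • d] and
    [a = e c^-1].  On a groupoid [⇀] and [↼] are actions, so inverse arrows act by
    inverse maps. *)
Require Import Defs.
From HB Require Import structures.
From mathcomp Require Import all_boot.
From mathcomp Require Import boolp classical_sets.
Set Implicit Arguments.
Unset Strict Implicit.
Unset Printing Implicit Defensive.
Local Open Scope group_scope.

Lemma tensor_eq V (Q : preQuiver V) (p q : tensor Q) :
  lft p = lft q -> rgt p = rgt q -> p = q.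
Proof.
case: p q => [x y h] [x' y' h'] /= ex ey; move: h h'; rewrite ex ey => h h'.
by congr Tensor; exact: Prop_irrelevance.
Qed.

(** * Identities for [f] and for left division in a dynamical skew brace *)

Section DynSkewBraceTheory.
Variables (V : Type) (A : groupType) (D : dyn_skew_brace V A).
Local Notation phi := (dsb_phi D).
Local Notation op := (dsb_op D).
Local Notation f := (dsb_f D).

Lemma dsb_op_inj l a : injective (op l a).
Proof. exact: bij_inj (dsb_bij D l a). Qed.

Lemma dsb_op_ldiv l a c : op l a (dsb_ldiv D l a c) = c.
Proof. by rewrite /dsb_ldiv; case: cid. Qed.

Lemma dsb_mul_f l a b : a * f l a b = op l a b.
Proof. by rewrite /dsb_f mulVKg. Qed.

(** Expand [op l a (b * b^-1) = op l a 1 = a] with [dsb_opM] and solve for the last factor. *)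
Lemma dsb_opV l a b : op l a b^-1 = a * (op l a b)^-1 * a.
Proof.
have := dsb_opM D l a b b^-1; rewrite mulgV dsb_op1 => e.
by rewrite [X in _ * X]e !mulgA mulgVK mulgV mul1g.
Qed.

Lemma dsb_f_op l a b c : f l a (f (phi l a) b c) = f l (op l a b) c.
Proof.
by rewrite {1 2}/dsb_f dsb_opM dsb_opV dsb_opA /dsb_f !mulgA mulVg mul1g mulgK.
Qed.

(** The label in [A] of [l || a] ↼ [phi l a || b]. *)
Definition dsb_g l a b := dsb_ldiv D l (f l a b) (op l a b).
Local Notation g := dsb_g.

Lemma dsb_f_g l a b : op l (f l a b) (g l a b) = op l a b.
Proof. exact: dsb_op_ldiv. Qed.

(** Both sides equal a^-1 ((a •_l b) •_l c): on the right, [e] is applied to u = f l a b and v = g l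
    a b, for which u •_l v = a •_l b. *)
Lemma dsb_f_opr l a b c :
  f l a (op (phi l a) b c) = op l (f l a b) (f (phi l (f l a b)) (g l a b) c).
Proof.
have e u v : op l u (f (phi l u) v c) = u * (op l u v)^-1 * op l (op l u v) c.
  by rewrite dsb_opM dsb_opV dsb_opA mulgK.
by rewrite e dsb_f_g /dsb_f dsb_opA mulgK.
Qed.

Lemma dsb_unitalP : dsb_unital D <-> zero_symmetric D.
Proof.
split=> [u l b | z l].
  have [a e] := u l; have /= := congr1 (fun p => aut_fun p.2 b) e.
  by have /= <- := congr1 fst e; rewrite /dsb_f invg1 mul1g => <-.
exists 1; congr pair; rewrite /dsb_f_aut /aut_id.
have e : f l 1 = id by apply: funext => b; rewrite /dsb_f z invg1 mul1g.
(* The proof fields depend on the function, so they are generalized before it is rewritten to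
   [id]. *)
move: (@dsb_f_morph V A D l 1) (dsb_f_bij D l 1); rewrite e => m bij.
by congr Automorphism; exact: Prop_irrelevance.
Qed.

(** Associativity with first factor 1 shows that [op (phi l 1)] and [op l] coincide. This supplies
    the premise of [dsb_unit_indexed]. *)
Lemma dsb_S_phi1 l : zero_symmetric D -> dsb_S D (phi l 1) = dsb_S D l.
Proof.
move=> z; have e a : dsb_f_aut D (phi l 1) a = dsb_f_aut D l a.
  have ef : f (phi l 1) a = f l a.
    by apply: funext => b; rewrite /dsb_f -{1}(z l (op _ _ _)) dsb_opA z.
  rewrite /dsb_f_aut.
  move: (@dsb_f_morph V A D (phi l 1) a) (dsb_f_bij D (phi l 1) a).
  move: (@dsb_f_morph V A D l a) (dsb_f_bij D l a); rewrite ef => m1 b1 m2 b2.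
  by congr Automorphism; exact: Prop_irrelevance.
by apply/seteqP; split=> p [a ->]; exists a; rewrite e.
Qed.

End DynSkewBraceTheory.

(** * The group of arrows with a fixed source *)

Section Fibre.
Variables (V : Type) (A : groupType) (D : dyn_skew_brace V A) (v : V).

(** A named copy of [out], to which the choice and group instances can be attached. *)
Definition dsb_fib : Type := out (dsb_quiver D) v.
Definition dsb_fib_arrow (a : A) : dsb_fib := exist _ (dsb_arrow D v a) erefl.
Definition dsb_fib_val (x : dsb_fib) : A := (sval x).2.

Lemma dsb_fib_valK : cancel dsb_fib_val dsb_fib_arrow.
Proof. by case=> -[m a] /= h; apply: eq_exist; congr pair. Qed.

HB.instance Definition _ := Choice.copy dsb_fib (can_type dsb_fib_valK).

Definition dsb_fib_mul x y := dsb_fib_arrow (dsb_fib_val x * dsb_fib_val y).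
Definition dsb_fib_inv x := dsb_fib_arrow (dsb_fib_val x)^-1.

Fact dsb_fib_mulA : associative dsb_fib_mul.
Proof. by move=> x y z; congr dsb_fib_arrow; exact: mulgA. Qed.
Fact dsb_fib_1mul : left_id (dsb_fib_arrow 1) dsb_fib_mul.
Proof. by move=> x; rewrite /dsb_fib_mul mul1g dsb_fib_valK. Qed.
Fact dsb_fib_mul1 : right_id (dsb_fib_arrow 1) dsb_fib_mul.
Proof. by move=> x; rewrite /dsb_fib_mul mulg1 dsb_fib_valK. Qed.
Fact dsb_fib_mulV : left_inverse (dsb_fib_arrow 1) dsb_fib_inv dsb_fib_mul.
Proof. by move=> x; congr dsb_fib_arrow; exact: mulVg. Qed.
Fact dsb_fib_Vmul : right_inverse (dsb_fib_arrow 1) dsb_fib_inv dsb_fib_mul.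
Proof. by move=> x; congr dsb_fib_arrow; exact: mulgV. Qed.

HB.instance Definition _ := isGroup.Build dsb_fib dsb_fib_mulA dsb_fib_1mul
  dsb_fib_mul1 dsb_fib_mulV dsb_fib_Vmul.

Definition dsb_fib_class : Group.axioms_ dsb_fib := Group.class dsb_fib.

End Fibre.

(** * The quiver-theoretic skew brace on [Q] and its braiding *)

Section AssociatedSkewBrace.
Variables (V : Type) (A : groupType) (D : dyn_skew_brace V A).
Hypothesis phi_op : forall (l : V) (a b : A),
  dsb_phi D l (dsb_op D l a b) = dsb_phi D (dsb_phi D l a) b.
Local Notation Q := (dsb_semiloopoid phi_op).
Local Notation phi := (dsb_phi D).
Local Notation op := (dsb_op D).
Local Notation f := (dsb_f D).
Local Notation g := (dsb_g D).

Lemma dsb_qskew_brace_law (x : Q) (y z : dsb_fib D (tgt x)) :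
  ltrans (sl_mul Q) (y * z) =
  (ltrans (sl_mul Q) y : dsb_fib D (src x))
    * (exist _ x erefl : dsb_fib D (src x))^-1
    * (ltrans (sl_mul Q) z : dsb_fib D (src x)).
Proof. by apply: eq_exist; congr pair; exact: dsb_opM. Qed.

Definition dsb_qskew_brace : qskew_brace_on Q :=
  @QSkewBrace V Q (dsb_fib_class D) dsb_qskew_brace_law.
Local Notation B := dsb_qskew_brace.
Local Notation sigma := (qsb_braiding B).

Lemma lft_sigma (p : tensor Q) : lft (sigma p) =
  dsb_arrow D (lft p).1 (f (lft p).1 (lft p).2 (rgt p).2).
Proof. by []. Qed.

(** Left division is obtained by choice and does not compute, so the arrow is characterized instead:
    composability gives its source, and cancelling [f l a b] on the left gives its label. *)
Lemma rgt_sigma (p : tensor Q) :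
  let: l := (lft p).1 in let: a := (lft p).2 in let: b := (rgt p).2 in
  rgt (sigma p) = dsb_arrow D (phi l (f l a b)) (g l a b).
Proof.
have h := composableP (sigma p).
have e := congr1 snd (@sl_ldivK _ Q _ _ (qsb_harp_src B (tensor_out p)) h).
rewrite [LHS]surjective_pairing; congr pair; first exact: esym h.
apply: (@dsb_op_inj _ _ D (lft p).1 (f (lft p).1 (lft p).2 (rgt p).2)).
by rewrite dsb_f_g; exact: e.
Qed.

(** The labels in x ↼ (y • z) = (x ↼ y) ↼ z; multiplied on the left by the label of x ⇀ (y • z),
    both become that of x • (y • z). *)
Lemma dsb_g_opr l a b c :
  g l a (op (phi l a) b c) = g (phi l (f l a b)) (g l a b) c.
Proof.
apply: (@dsb_op_inj _ _ D l (f l a (op (phi l a) b c))).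
by rewrite dsb_f_g dsb_f_opr -!dsb_opA dsb_f_g [RHS]dsb_opA dsb_f_g dsb_opA.
Qed.

(** The labels in (x • y) ↼ z = (x ↼ (y ⇀ z)) • (y ↼ z), where [u] is the label of y ⇀ z. *)
Lemma dsb_g_opl l a b c (u := f (phi l a) b c) :
  g l (op l a b) c = op (phi l (f l a u)) (g l a u) (g (phi l a) b c).
Proof.
apply: (@dsb_op_inj _ _ D l (f l (op l a b) c)).
rewrite dsb_f_g -dsb_f_op dsb_opA dsb_f_g -!dsb_opA.
by rewrite /u dsb_f_g.
Qed.

Lemma sigma_bij : bijective sigma.
Proof.
(* [sigma] preserves the composite [e], and its first output label is c = a^-1 e; hence a = e
   c^-1. *)
pose e (q : tensor Q) := op (lft q).1 (lft q).2 (rgt q).2.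
pose a (q : tensor Q) := e q / (lft q).2.
pose tau (q : tensor Q) : tensor Q :=
  Tensor (dsb_arrow D (lft q).1 (a q))
    (dsb_arrow D (phi (lft q).1 (a q)) (dsb_ldiv D (lft q).1 (a q) (e q))) erefl.
have e_sigma p : e (sigma p) = e p by rewrite /e lft_sigma rgt_sigma /= dsb_f_g.
have a_sigma p : a (sigma p) = (lft p).2.
  by rewrite /a e_sigma lft_sigma /= /dsb_f invgM invgK mulVKg.
have f_tau (q : tensor Q) : f (lft q).1 (a q) (dsb_ldiv D (lft q).1 (a q) (e q)) = (lft q).2.
  by rewrite /dsb_f dsb_op_ldiv /a invgM invgK mulgVK.
exists tau => [p | q]; apply: tensor_eq.
- by rewrite /= a_sigma; case: (lft p).
- rewrite /= a_sigma e_sigma [RHS]surjective_pairing; congr pair.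
    exact: composableP p.
  by apply: (@dsb_op_inj _ _ D (lft p).1 (lft p).2); rewrite dsb_op_ldiv.
- by rewrite lft_sigma /= f_tau; case: (lft q).
rewrite rgt_sigma /= f_tau [RHS]surjective_pairing; congr pair.
  exact: composableP q.
apply: (@dsb_op_inj _ _ D (lft q).1 (lft q).2).
by rewrite -{1}f_tau dsb_f_g dsb_op_ldiv.
Qed.

Lemma sigma_braiding : is_braiding sigma.
Proof.
(* The right-hand sides of [L], [R] and [M] do not mention composability proofs, so each law becomes
   an identity of sources and labels. *)
have L (x y : Q) h :
  lft (sigma (Tensor x y h)) = dsb_arrow D x.1 (f x.1 x.2 y.2) by [].
have R (x y : Q) h : rgt (sigma (Tensor x y h)) =
  dsb_arrow D (phi x.1 (f x.1 x.2 y.2)) (g x.1 x.2 y.2) by rewrite rgt_sigma.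
have M (x y : Q) h :
  sl_mul Q (Tensor x y h) = dsb_arrow D x.1 (op x.1 x.2 y.2) by [].
split; first exact: sigma_bij.
- move=> [l a] hs ht; have f1 : f l a 1 = 1 by rewrite /dsb_f dsb_op1 mulVg.
  apply: tensor_eq; rewrite ?L ?R /= f1 //.
  (* By [hs] the vertex [l] is a target, whence [phi l 1 = l]. *)
  congr pair; first exact: (dsb_phi1 phi_op hs).
  apply: (@dsb_op_inj _ _ D l 1); rewrite -{1}f1 dsb_f_g dsb_op1.
  by rewrite (dsb_1op _ hs).
- move=> [l a] hs ht.
  have f1 : f l 1 a = a by rewrite /dsb_f (dsb_1op _ hs) invg1 mul1g.
  apply: tensor_eq; rewrite ?L ?R /= f1 //; congr pair.
  apply: (@dsb_op_inj _ _ D l a).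
  by rewrite -{1}f1 dsb_f_g dsb_op1 (dsb_1op _ hs).
- move=> [l a] [m b] [n c] hxy hyz h1 h2 h3; rewrite !(L, M, R) /=.
  by rewrite -[m]hxy /= dsb_f_opr.
- move=> [l a] [m b] [n c] hxy hyz h1 h2; rewrite !(L, M, R) /=.
  (* [phi_op] matches the sources of the two arrows. *)
  by rewrite -[m]hxy /= dsb_g_opr dsb_f_opr phi_op.
- move=> [l a] [m b] [n c] hxy hyz h1 h2 h3; rewrite !(L, M, R) /=.
  by rewrite -[m]hxy /= dsb_g_opl dsb_f_op.
- move=> [l a] [m b] [n c] hxy hyz h1 h2; rewrite !(L, M, R) /=.
  by rewrite -[m]hxy /= dsb_f_op.
by move=> [l a] [m b] h h'; rewrite !(L, M, R) /= dsb_f_g.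
Qed.

End AssociatedSkewBrace.

(** * Non-degeneracy of an arbitrary braiding on a groupoid *)

Section GroupoidBraiding.
Variables (V : Type) (G : semiloopoid V) (s : qmorphism (tensor G) (tensor G)).
Hypotheses (G_groupoid : is_groupoid G) (s_braiding : is_braiding s).
Local Notation "'one' v" := (sl_one (G_groupoid v)) (at level 10).

Lemma sl_mul_inj (x y z : G) h h' :
  sl_mul G (Tensor x y h) = sl_mul G (Tensor x z h') -> y = z.
Proof.
move=> e; pose out_of t (k : tgt x = src t) : out G (tgt x) := exist _ t (esym k).
suff /(congr1 sval) : out_of y h = out_of z h' by [].
apply: (bij_inj (sl_bij x)); apply: eq_exist.
by rewrite (Prop_irrelevance (esym _) h) (Prop_irrelevance (esym _) h').
Qed.

(** Surjectivity of x • _ gives a right inverse x'. It is also a left inverse: x • (x' • x) = x = x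
    • 1, and x cancels. *)
Lemma groupoid_inv (x : G) : exists (x' : G) h h',
  sl_mul G (Tensor x x' h) = one (src x) /\
  sl_mul G (Tensor x' x h') = one (tgt x).
Proof.
have [[x' hx'] /(congr1 sval) /= xx'] :=
  bijective_preim (sl_bij x) (exist _ (one (src x)) (sl_one_src _)).
have h' : tgt x' = src x.
  by have := congr1 (@tgt V G) xx'; rewrite qfun_tgt sl_one_tgt.
have e : sl_mul G (Tensor x x' (esym hx')) = one (src x).
  by rewrite -xx'; congr (sl_mul G _); exact: tensor_eq.
exists x', (esym hx'), h'; split=> //.
have h1 : tgt x = src (sl_mul G (Tensor x' x h')) by rewrite qfun_src.
have h2 : tgt x = src (one (tgt x)) by rewrite sl_one_src.
apply: (@sl_mul_inj x _ _ h1 h2); rewrite sl_mul1.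
have h3 : tgt (sl_mul G (Tensor x x' (esym hx'))) = src x by rewrite qfun_tgt.
rewrite -(sl_mulA h3); move: h3; rewrite e => h3; exact: sl_1mul.
Qed.

(** x ⇀ (x' ⇀ y) = (x • x') ⇀ y = 1 ⇀ y = y. The vertex [v] is left free so that both equations of
    [groupoid_inv] fit; composability forces [v = src y]. *)
Lemma harp_inv (x x' y : G) v h h1 h2 :
  sl_mul G (Tensor x x' h) = one v ->
  lft (s (Tensor x (lft (s (Tensor x' y h1))) h2)) = y.
Proof.
have h3 : tgt (sl_mul G (Tensor x x' h)) = src y by rewrite qfun_tgt.
rewrite -(braiding_harpA s_braiding h3); move: h3 => /[swap] -> h3.
have ev : v = src y by rewrite -h3 sl_one_tgt.
move: h3; rewrite ev => h3; rewrite (Prop_irrelevance h3 (sl_one_tgt _)).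
by rewrite (braiding_1x s_braiding _ (G_groupoid _)).
Qed.

Lemma larp_inv (x y y' : G) v h h1 h2 :
  sl_mul G (Tensor y y' h) = one v ->
  rgt (s (Tensor (rgt (s (Tensor x y h1))) y' h2)) = x.
Proof.
have h3 : tgt x = src (sl_mul G (Tensor y y' h)) by rewrite qfun_src.
rewrite -(braiding_larpA s_braiding h3); move: h3 => /[swap] -> h3.
have ev : v = tgt x by rewrite h3 sl_one_src.
move: h3; rewrite ev => h3; rewrite (Prop_irrelevance h3 (esym (sl_one_src _))).
by rewrite (braiding_x1 s_braiding (G_groupoid _)).
Qed.

Lemma groupoid_braiding_nondegenerate : nondegenerate s.
Proof.
split=> x; have [x' [h [h' [e e']]]] := groupoid_inv x.
  have k (z : out G (src x)) : tgt x' = src (sval z) by rewrite (svalP z).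
  have ks z : src (s (Tensor x' (sval z) (k z))) = tgt x by rewrite qfun_src.
  exists (fun z : out G (src x) =>
      exist (fun y : G => src y = tgt x) (lft (s (Tensor x' (sval z) (k z))))
        (ks z)) => z; case: (z) => y hy.
    by apply: eq_exist; exact: harp_inv e'.
  by apply: eq_exist; exact: harp_inv e.
(* Here [x] acts from the right, and _ ↼ x' is the inverse map. *)
have k (z : inn G (tgt x)) : tgt (sval z) = src x' by rewrite (svalP z).
have kt z : tgt (s (Tensor (sval z) x' (k z))) = src x by rewrite qfun_tgt.
exists (fun z : inn G (tgt x) =>
    exist (fun y : G => tgt y = src x) (rgt (s (Tensor (sval z) x' (k z))))
      (kt z)) => z; case: (z) => y hy.
  by apply: eq_exist; exact: larp_inv e.
by apply: eq_exist; exact: larp_inv e'.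
Qed.

End GroupoidBraiding.

Theorem mainTheorem2 (V : Type) (A : groupType) (D : dyn_skew_brace V A)
    (phi_op : forall (l : V) (a b : A),
      dsb_phi D l (dsb_op D l a b) = dsb_phi D (dsb_phi D l a) b) :
  let Q := dsb_semiloopoid phi_op in
  (dsb_unital D <-> zero_symmetric D) /\
  exists B : qskew_brace_on Q,
    [/\ forall (l : V) (a b : A),
          (exist _ (dsb_arrow D l a) erefl : qsb_fib B l)
            * (exist _ (dsb_arrow D l b) erefl : qsb_fib B l) =
          exist _ (dsb_arrow D l (a * b)) erefl,
        is_braiding (qsb_braiding B),
        forall (l : V) (a b : A),
          let f := dsb_f D in
          let p : tensor Q :=
            Tensor (dsb_arrow D l a) (dsb_arrow D (dsb_phi D l a) b) erefl in
          qsb_braiding B p =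
            Tensor
              (dsb_arrow D l (a^-1 * dsb_op D l a b))
              (dsb_arrow D (dsb_phi D l (a^-1 * dsb_op D l a b))
                 (dsb_ldiv D l (a^-1 * dsb_op D l a b) (dsb_op D l a b)))
              erefl /\
          qsb_braiding B p =
            Tensor
              (dsb_arrow D l (f l a b))
              (dsb_arrow D (dsb_phi D l (f l a b))
                 (dsb_ldiv D l (f l a b) (a * f l a b)))
              erefl
      & dsb_unital D ->
        dsb_unit_indexed D ->
        is_skew_bracoid B /\ nondegenerate (qsb_braiding B)].
Proof.
split; first exact: dsb_unitalP.
exists (dsb_qskew_brace phi_op); split=> [||l a b|u ui] //.
- exact: sigma_braiding.
- split; apply: tensor_eq; rewrite ?lft_sigma ?rgt_sigma //=.
  by rewrite /dsb_g dsb_mul_f.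
have gpd : is_groupoid (dsb_semiloopoid phi_op).
  (* The arrow [v || 1] is a loop at [v], so every vertex is a target. *)
  by move=> v; exists (v, 1); apply: ui; apply: dsb_S_phi1; apply/dsb_unitalP.
split=> //; apply: groupoid_braiding_nondegenerate => //; exact: sigma_braiding.
Qed.
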